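(* Let $Q_1,\dots,Q_N\in SO(n)$ with weights $w_1,\dots,w_N>0$, and let $C_e=\frac1W\sum_{k=1}^N w_kQ_k\in\mathbb{R}^{n\times n}$, $W=\sum_{k=1}^N w_k$. Let $IAM\subseteq SO(n)$ denote the induced arithmetic mean of the $Q_k$. Consider the orthogonal matrices $U$ obtained from polar decompositions $C_e=UR$ ($U$ orthogonal, $R$ symmetric positive semi-definite). Then: (1) If $\det(C_e)\ge 0$, then $IAM=\{U:\det(U)>0\}$, i.e. $IAM$ is the set of all $U$ with $\det(U)>0$ arising from a polar decomposition $C_e=UR$. It reduces to a single point if the multiplicity of $0$ as an eigenvalue of $C_e$ is less than or equal to $1$. (2) If $\det(C_e)\le 0$, then $IAM=\{UHJH^T\}$, where $U$ ranges over the matrices with $\det(U)<0$ arising from a polar decomposition $C_e=UR$, $H$ ranges over the orthogonal $n\times n$ matrices whose columns are orthonormalized eigenvectors of $R$ with an eigenvector corresponding to the smallest eigenvalue of $R$ in the first column, and $J=\begin{pmatrix}-1&0\\0&I_{n-1}\end{pmatrix}$. The $IAM$ reduces to a single point if the smallest eigenvalue of $R$ has multiplicity $1$.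
   Context: $SO(n)$ is the set of real $n\times n$ orthogonal matrices with determinant $+1$, embedded in $\mathbb{R}^{n\times n}$ with the Frobenius norm $\|B\|=\sqrt{\mathrm{trace}(B^TB)}$. The induced arithmetic mean of points $Q_1,\dots,Q_N\in SO(n)$ with weights $w_k>0$ is the set of global minimizers $$IAM=\mathop{\mathrm{argmin}}_{c\in SO(n)}\sum_{k=1}^N w_k\|Q_k-c\|^2 ,$$ equivalently $IAM=\mathop{\mathrm{argmax}}_{c\in SO(n)}\mathrm{trace}(c^TC_e)$. In any polar decomposition $B=UR$ of a square matrix, $R=(B^TB)^{1/2}$ is unique, and $U$ is unique if $B$ is nonsingular. $I_{n-1}$ is the identity matrix of size $n-1$. *)

(* Defs.v *)
From mathcomp Require Import all_boot all_order all_algebra.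
From mathcomp Require Import all_classical all_reals.

Set Implicit Arguments.
Unset Strict Implicit.
Unset Printing Implicit Defensive.

Import Order.TTheory GRing.Theory Num.Theory.
Local Open Scope classical_set_scope.
Local Open Scope ring_scope.

Definition orthogonal_mx (R : realType) (n : nat) (A : 'M[R]_n) : Prop :=
  A^T *m A = 1%:M.

Definition SO (R : realType) (n : nat) : set 'M[R]_n :=
  [set A | orthogonal_mx A /\ \det A = 1].

Definition frobenius (R : realType) (n : nat) (B : 'M[R]_n) : R :=
  Num.sqrt (\tr (B^T *m B)).

Definition argmin_on (R : realType) (T : Type) (D : set T) (f : T -> R) : set T :=
  [set c | D c /\ forall c', D c' -> f c <= f c'].

Definition IAM (R : realType) (n N : nat) (w : 'I_N -> R) (Q : 'I_N -> 'M[R]_n) :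
    set 'M[R]_n :=
  argmin_on (@SO R n) (fun c => \sum_(k < N) w k * frobenius (Q k - c) ^+ 2).

Definition centroid (R : realType) (n N : nat) (w : 'I_N -> R)
    (Q : 'I_N -> 'M[R]_n) : 'M[R]_n :=
  (\sum_(k < N) w k)^-1 *: \sum_(k < N) w k *: Q k.

Definition psd_mx (R : realType) (n : nat) (P : 'M[R]_n) : Prop :=
  P^T = P /\ forall v : 'cV[R]_n, 0 <= (v^T *m P *m v) 0 0.

Definition polar_decomposition (R : realType) (n : nat) (B U P : 'M[R]_n) : Prop :=
  [/\ orthogonal_mx U, psd_mx P & B = U *m P].

Definition eigenvector (R : realType) (n : nat) (A : 'M[R]_n) (a : R)
    (v : 'cV[R]_n) : Prop :=
  v != 0 /\ A *m v = a *: v.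

(* [eigenspace] consists of row vectors, i.e. left eigenvectors; its dimension
   is nevertheless the (geometric) multiplicity of [a], since A - a and its
   transpose have the same rank. *)
Definition multiplicity (R : realType) (n : nat) (A : 'M[R]_n) (a : R) : nat :=
  \rank (eigenspace A a).

Definition smallest_eigenvalue (R : realType) (n : nat) (A : 'M[R]_n) (a : R) : Prop :=
  eigenvalue A a /\ forall b, eigenvalue A b -> a <= b.

Definition smallest_first_eigenbasis (R : realType) (n : nat)
    (P H : 'M[R]_n.+1) : Prop :=
  [/\ orthogonal_mx H,
      forall j, exists a, eigenvector P a (col j H)
    & exists2 a, smallest_eigenvalue P a & eigenvector P a (col ord0 H)].

Definition flip_first (R : realType) (n : nat) : 'M[R]_n.+1 :=
  block_mx (- 1%:M : 'M_1) 0 0 (1%:M : 'M_n).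

(* Main.v *)
Require Import Defs.
From mathcomp Require Import all_boot all_order all_algebra.
From mathcomp Require Import all_classical all_reals.
From mathcomp Require Import spectral complex.
From mathcomp Require Import ring lra.

Set Implicit Arguments.
Unset Strict Implicit.
Unset Printing Implicit Defensive.

Import Order.TTheory GRing.Theory Num.Theory.
Local Open Scope classical_set_scope.
Local Open Scope ring_scope.

(* On SO(n) the cost is a constant minus a positive multiple of tr(c^T Ce), so
   the IAM is the set of maximizers of that trace.  Write Ce = U P (polar) and
   O = c^T U, so that tr(c^T Ce) = tr(O P).

   For orthogonal O, 2 (tr P - tr(O P)) = tr((O - 1) P (O - 1)^T) >= 0, with
   equality iff O P = P.  This settles the case where U can be chosen with
   determinant 1.

   If det U = -1 then O has an eigenvector v for -1; applying the bound to
   O (1 - 2 v v^T) gives tr O <= n - 2, and splitting P = a + (P - a), where a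
   is the smallest eigenvalue, gives tr(O P) <= tr P - 2 a.  For a > 0 equality
   forces O = 1 - 2 v v^T with P v = a v, and H J H^T is exactly this reflection
   for v the first column of H.  If a = 0 then equality gives O P = P, and U may
   be replaced by its product with a reflection along the kernel of P.

   Polar decompositions come from a singular value decomposition, obtained like
   the spectral theorem by deflation with Householder matrices. *)

Section RealMatrices.
Variable R : realType.

Lemma trmxB m p (A B : 'M[R]_(m, p)) : (A - B)^T = A^T - B^T.
Proof. exact: linearB. Qed.

Lemma trmxZ m p (a : R) (A : 'M[R]_(m, p)) : (a *: A)^T = a *: A^T.
Proof. exact: linearZ. Qed.

(** * Unit vectors and orthogonal matrices *)

Lemma sqnormE m (v : 'cV[R]_m) : (v^T *m v) 0 0 = \sum_i v i 0 ^+ 2.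
Proof. by rewrite mxE; apply: eq_bigr => i _; rewrite mxE expr2. Qed.

Lemma sqnorm_ge0 m (v : 'cV[R]_m) : 0 <= (v^T *m v) 0 0.
Proof. by rewrite sqnormE sumr_ge0 // => i _; rewrite sqr_ge0. Qed.

Lemma sqnorm_eq0 m (v : 'cV[R]_m) : ((v^T *m v) 0 0 == 0) = (v == 0).
Proof.
apply/eqP/eqP => [|->]; last by rewrite mulmx0 mxE.
rewrite sqnormE => /psumr_eq0P v0; apply/matrixP => i j.
by rewrite ord1 mxE; apply/eqP; rewrite -sqrf_eq0 v0 // => k _; rewrite sqr_ge0.
Qed.

Lemma normalize m (v : 'cV[R]_m) :
  v != 0 -> exists2 s : R, s != 0 & (s *: v)^T *m (s *: v) = 1%:M.
Proof.
move=> v0; have q_gt0 : 0 < (v^T *m v) 0 0.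
  by rewrite lt_neqAle eq_sym sqnorm_eq0 v0 sqnorm_ge0.
exists (Num.sqrt ((v^T *m v) 0 0))^-1.
  by rewrite invr_eq0 sqrtr_eq0 -ltNge.
rewrite trmxZ -scalemxAl -scalemxAr scalerA -expr2 exprVn sqr_sqrtr ?ltW //.
by rewrite {2}[v^T *m v]mx11_scalar scale_scalar_mx mulVf ?gt_eqF.
Qed.

Lemma unit_ker m (A : 'M[R]_m) :
  \det A = 0 -> exists2 v : 'cV[R]_m, v^T *m v = 1%:M & A *m v = 0.
Proof.
move=> dA; have : \det A^T = 0 by rewrite det_tr.
move/eqP/det0P => [v v0 vA].
have [s s0 sv] : exists2 s : R, s != 0 & (s *: v^T)^T *m (s *: v^T) = 1%:M.
  by apply: normalize; rewrite trmx_eq0.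
exists (s *: v^T) => //; rewrite -scalemxAr -[A *m _]trmxK trmx_mul trmxK vA.
by rewrite trmx0 scaler0.
Qed.

Lemma unit_neq0 m (v : 'cV[R]_m) : v^T *m v = 1%:M -> v != 0.
Proof.
by move=> vv; rewrite -sqnorm_eq0 vv mxE eqxx oner_eq0.
Qed.

Lemma orthogonal_mulmxT m (A : 'M[R]_m) : orthogonal_mx A -> A *m A^T = 1%:M.
Proof. exact: mulmx1C. Qed.

Lemma orthogonal_tr m (A : 'M[R]_m) : orthogonal_mx A -> orthogonal_mx A^T.
Proof. by move/orthogonal_mulmxT; rewrite /orthogonal_mx trmxK. Qed.

Lemma orthogonal_mul m (A B : 'M[R]_m) :
  orthogonal_mx A -> orthogonal_mx B -> orthogonal_mx (A *m B).
Proof.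
rewrite /orthogonal_mx => oA oB.
by rewrite trmx_mul mulmxA -(mulmxA B^T) oA mulmx1 oB.
Qed.

Lemma det_orthogonal m (A : 'M[R]_m) :
  orthogonal_mx A -> \det A = 1 \/ \det A = -1.
Proof.
move/(congr1 determinant); rewrite det_mulmx det_tr det1 -expr2 => /eqP.
by rewrite sqrf_eq1 => /orP[] /eqP; [left | right].
Qed.

Lemma orthogonal_block m (K : 'M[R]_m) :
  orthogonal_mx K -> orthogonal_mx (block_mx (1%:M : 'M_1) 0 0 K : 'M_m.+1).
Proof.
move=> oK; rewrite /orthogonal_mx (@tr_block_mx _ 1 m 1 m).
rewrite (@mulmx_block _ 1 m 1 m 1 m).
rewrite !trmx0 trmx1 !mulmx0 !mul0mx !mulmx1 !addr0 add0r oK.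
by rewrite [RHS](@scalar_mx_block _ 1 m).
Qed.

(** Completes a unit vector to an orthonormal basis, the starting point of each deflation. *)
Lemma householder m (v : 'cV[R]_m.+1) :
  v^T *m v = 1%:M -> exists2 H, orthogonal_mx H & col ord0 H = v.
Proof.
move=> vv; pose e : 'cV[R]_m.+1 := delta_mx 0 0.
have ee : e^T *m e = 1%:M.
  by rewrite trmx_delta mul_delta_mx; apply/matrixP => i j; rewrite !ord1 !mxE.
have ve : v^T *m e = (v 0 0)%:M.
  by rewrite -colE [LHS]mx11_scalar !mxE.
have ev : e^T *m v = (v 0 0)%:M.
  by rewrite -[LHS]trmxK trmx_mul trmxK ve tr_scalar_mx.
have [->|nve] := eqVneq v e.
  by exists 1%:M; [rewrite /orthogonal_mx trmx1 mulmx1|rewrite colE mul1mx].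
(* Since |w|^2 = 2 t, the coefficient 2 / |w|^2 of the reflection along w is t^-1; t vanishes only
   if v = e. *)
pose w := v - e; pose t := 1 - v 0 0.
have ww : w^T *m w = (2 * t)%:M.
  rewrite /w trmxB mulmxBl !mulmxBr vv ee ve ev /t.
  by rewrite -!raddfB /=; congr (_%:M); ring.
have t0 : t != 0.
  apply: contra_neq nve => t0; apply/eqP; rewrite -subr_eq0 -sqnorm_eq0.
  by rewrite ww t0 mulr0 mxE.
(* The reflection exchanging e and v. *)
exists (1%:M - t^-1 *: (w *m w^T)).
  rewrite /orthogonal_mx trmxB trmxZ trmx_mul trmxK trmx1.
  rewrite mulmxBl !mulmxBr mul1mx mulmx1 mul1mx -scalemxAl -scalemxAr scalerA.
  rewrite mulmxA -(mulmxA w w^T) ww mul_mx_scalar -scalemxAl !scalerA.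
  rewrite (_ : t^-1 / t * (2 * t) = t^-1 + t^-1); last by field.
  by rewrite scalerDl; set z := _ *: _; rewrite opprB addrK subrK.
rewrite colE mulmxBl mul1mx -scalemxAl -mulmxA.
have -> : w^T *m e = (- t)%:M.
  by rewrite /w trmxB mulmxBl ve ee -raddfB /= /t opprB.
by rewrite mul_mx_scalar scalerA mulrN mulVf // scaleN1r opprK -/e addrC subrK.
Qed.

(** * Spectral theorem and singular values *)

(* If x + i y is a complex eigenvalue of A, then (A - x)^2 + y^2 is singular;
   a real kernel vector u satisfies |(A - x) u|^2 + y^2 |u|^2 = 0. *)
Lemma symmetric_unit_eigenvector m (A : 'M[R]_m.+1) : A^T = A ->
  exists a (v : 'cV[R]_m.+1), v^T *m v = 1%:M /\ A *m v = a *: v.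
Proof.
move=> sA; pose C : numClosedFieldType := complex.complex R.
pose toC : {rmorphism R -> C} := complex.real_complex R.
have [z /eigenvalueP[v vA v0]] := eigenvalue_closed (map_mx toC A) (ltn0Sn m).
pose x := complex.Re z; pose y := complex.Im z.
pose B := A - x%:M.
have zE : (z - toC x) ^+ 2 = - toC (y ^+ 2).
  rewrite (complex.complexE z) rmorphXn /= -/x -/y addrC addrA.
  by rewrite addNr add0r exprMn complex.sqr_i mulN1r.
have dM : \det (B *m B + (y ^+ 2)%:M) = 0.
  apply: (fmorph_inj toC); rewrite rmorph0 -det_map_mx; apply/eqP/det0P.
  exists v => //; rewrite map_mxD map_mxM map_scalar_mx /B map_mxB map_scalar_mx.
  have vB : v *m (map_mx toC A - (toC x)%:M) = (z - toC x) *: v.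
    by rewrite mulmxBr vA mul_mx_scalar scalerBl.
  rewrite mulmxDr mulmxA vB -scalemxAl vB scalerA -expr2 zE mul_mx_scalar.
  by rewrite scaleNr addNr.
have [u uu Mu] := unit_ker dM.
have sB : B^T = B by rewrite /B trmxB sA tr_scalar_mx.
have : ((B *m u)^T *m (B *m u)) 0 0 + y ^+ 2 = 0.
  move: (congr1 (fun C => (u^T *m C) 0 0) Mu) => /=.
  rewrite mulmx0 mulmxDl mul_scalar_mx mulmxDr -scalemxAr uu.
  by rewrite trmx_mul sB !mulmxA !mxE eqxx mulr1 => ->.
move/eqP; rewrite paddr_eq0 ?sqnorm_ge0 ?sqr_ge0 // sqnorm_eq0 => /andP[Bu _].
exists x, u; split=> //; apply/eqP.
by rewrite -subr_eq0 -mul_scalar_mx -mulmxBl.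
Qed.

(** The first column of X^T B Y is X^T (B v) = s X^T u = s e_0, and dually for the first row.
    Keeping X and Y apart serves the spectral theorem (X = Y) and singular values alike. *)
Lemma deflate m (B : 'M[R]_m.+1) (s : R) (u v : 'cV[R]_m.+1) (X Y : 'M[R]_m.+1) :
  orthogonal_mx X -> orthogonal_mx Y -> col ord0 X = u -> col ord0 Y = v ->
  B *m v = s *: u -> u^T *m B = s *: v^T ->
  X^T *m B *m Y =
    block_mx (s%:M : 'M_1) 0 0 (@drsubmx _ 1 m 1 m (X^T *m B *m Y)).
Proof.
move=> oX oY Xu Yv Bv uB; set M := X^T *m B *m Y.
have c0 i : M i 0 = s *+ (i == 0).
  transitivity (col 0 M i 0); first by rewrite [RHS]mxE.
  rewrite /M colE -mulmxA -colE Yv -mulmxA Bv -scalemxAr -Xu colE mulmxA oX mul1mx.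
  by rewrite !mxE andbT mulr_natr.
have r0 j : M 0 j = s *+ (j == 0).
  transitivity (row 0 M 0 j); first by rewrite [RHS]mxE.
  rewrite /M rowE mulmxA mulmxA -rowE -tr_col Xu uB -scalemxAl -Yv tr_col rowE.
  by rewrite -mulmxA oY mulmx1 !mxE /= mulr_natr.
clearbody M; apply: (etrans (esym (@submxK _ 1 m 1 m M))).
congr (block_mx _ _ _ _); apply/matrixP => i j.
- by rewrite !ord1 !mxE lshift0 c0 mulr1n.
- by rewrite !ord1 !mxE lshift0 r0 -val_eqE.
- by rewrite !ord1 !mxE lshift0 c0 -val_eqE.
Qed.

Lemma mul_block_diag m (K L : 'M[R]_m) (d : 'rV[R]_m) (s : R) :
  block_mx (s%:M : 'M_1) 0 0 (K *m diag_mx d *m L^T) =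
  block_mx 1%:M 0 0 K *m diag_mx (row_mx (s%:M : 'M_1) d) *m
    (block_mx (1%:M : 'M_1) 0 0 L)^T.
Proof.
rewrite diag_mx_row tr_block_mx !mulmx_block !trmx0 trmx1.
rewrite !(mulmx0, mul0mx, mulmx1, mul1mx, addr0, add0r).
by congr (block_mx _ _ _ _); apply/matrixP => i j; rewrite !ord1 !mxE eqxx mulr1n.
Qed.

Lemma svd_step m (B X Y : 'M[R]_m.+1) (K L : 'M[R]_m) (d : 'rV[R]_m) (s : R) :
  orthogonal_mx X -> orthogonal_mx Y ->
  X^T *m B *m Y = block_mx (s%:M : 'M_1) 0 0 (K *m diag_mx d *m L^T) ->
  B = (X *m block_mx (1%:M : 'M_1) 0 0 K)
      *m diag_mx (row_mx (s%:M : 'M_1) d : 'rV_m.+1)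
      *m (Y *m block_mx (1%:M : 'M_1) 0 0 L)^T.
Proof.
move=> oX oY; rewrite mul_block_diag => E.
rewrite trmx_mul !mulmxA -2!(mulmxA X) -E !mulmxA orthogonal_mulmxT //.
by rewrite mul1mx -mulmxA orthogonal_mulmxT // mulmx1.
Qed.

(** Ensures that a prescribed first eigenvector survives the recursion. *)
Lemma col0_mul_block m (X : 'M[R]_m.+1) (K : 'M[R]_m) :
  col ord0 (X *m block_mx (1%:M : 'M_1) 0 0 K) = col ord0 X.
Proof.
rewrite !colE -mulmxA; congr (_ *m _); rewrite -colE.
apply/matrixP => i j; rewrite ord1 !mxE.
by case: splitP => k ik; rewrite !mxE; case: splitP => // l _;
  rewrite !mxE ?ord1 -!val_eqE /= ik ?ord1.
Qed.

(** The first column is prescribed so that eigenbases starting with a chosen eigenvector can be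
    built later; inside the induction the eigenvector of the lower right block is arbitrary. *)
Theorem spectral_first m (A : 'M[R]_m.+1) (a : R) (v : 'cV[R]_m.+1) :
  A^T = A -> v^T *m v = 1%:M -> A *m v = a *: v ->
  exists H d, [/\ orthogonal_mx H, col ord0 H = v & A = H *m diag_mx d *m H^T].
Proof.
elim: m A a v => [|m IH] A a v sA vv Av;
  have [H oH Hv] := householder vv;
  have vA : v^T *m A = a *: v^T by rewrite -trmxZ -Av trmx_mul sA.
all: have E := deflate oH oH Hv Hv Av vA.
  exists (H *m block_mx (1%:M : 'M_1) 0 0 1%:M), (row_mx (a%:M : 'M_1) 0).
  split; [|by rewrite col0_mul_block|].
    apply: orthogonal_mul => //; apply: orthogonal_block.
    by rewrite /orthogonal_mx trmx1 mulmx1.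
  by apply: svd_step => //; rewrite [_ *m 1%:M^T]flatmx0 E [drsubmx _]flatmx0.
move: E; set B := drsubmx _ => E.
have sB : B^T = B by rewrite /B trmx_drsub !trmx_mul trmxK sA mulmxA.
have [b [u [uu Bu]]] := symmetric_unit_eigenvector sB.
have [K [d [oK _ BE]]] := IH _ _ _ sB uu Bu.
exists (H *m block_mx (1%:M : 'M_1) 0 0 K), (row_mx (a%:M : 'M_1) d); split.
- by apply: orthogonal_mul => //; apply: orthogonal_block.
- by rewrite col0_mul_block.
- by apply: svd_step => //; rewrite -BE.
Qed.

Theorem svd m (B : 'M[R]_m) :
  exists (X Y : 'M[R]_m) (d : 'rV[R]_m), [/\ orthogonal_mx X, orthogonal_mx Y,
    forall i, 0 <= d 0 i & B = X *m diag_mx d *m Y^T].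
Proof.
elim: m B => [|m IH] B.
  exists 1%:M, 1%:M, 0; split; rewrite /orthogonal_mx ?trmx1 ?mulmx1 //.
    by move=> i; rewrite mxE.
  by apply/matrixP => - [].
have sB : (B^T *m B)^T = B^T *m B by rewrite trmx_mul trmxK.
have [a [v [vv Av]]] := symmetric_unit_eigenvector sB.
have aE : a = ((B *m v)^T *m (B *m v)) 0 0.
  by rewrite trmx_mul -mulmxA (mulmxA B^T) Av -scalemxAr vv !mxE eqxx mulr1.
have [s [u [s0 uu Bv uB]]] : exists s u,
    [/\ 0 <= s, u^T *m u = 1%:M, B *m v = s *: u & u^T *m B = s *: v^T].
  (* If B v = 0, the singular value is 0 and any unit vector of the left kernel serves as u;
     otherwise s = sqrt a with a = |B v|^2, and u = B v / s. *)
  have [Bv0|Bv0] := eqVneq (B *m v) 0.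
    have : \det B^T = 0.
      rewrite det_tr -det_tr; apply/eqP/det0P; exists v^T.
        by rewrite trmx_eq0 unit_neq0.
      by rewrite -trmx_mul Bv0 trmx0.
    case/unit_ker => u uu Bu; exists 0, u; rewrite !scale0r; split=> //.
    by rewrite -[LHS]trmxK trmx_mul trmxK Bu trmx0.
  have a0 : 0 < a by rewrite lt_neqAle eq_sym aE sqnorm_eq0 Bv0 sqnorm_ge0.
  have s0 : 0 < Num.sqrt a by rewrite sqrtr_gt0.
  have ss : Num.sqrt a * Num.sqrt a = a by rewrite -expr2 sqr_sqrtr ?ltW.
  exists (Num.sqrt a), ((Num.sqrt a)^-1 *: (B *m v)); split.
  - exact: ltW.
  - rewrite trmxZ -scalemxAl -scalemxAr scalerA [_^T *m _]mx11_scalar -aE.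
    by rewrite scale_scalar_mx -invfM ss mulVf ?gt_eqF.
  - by rewrite scalerA divff ?scale1r ?gt_eqF.
  - rewrite trmxZ -scalemxAl trmx_mul -mulmxA.
    have -> : v^T *m (B^T *m B) = a *: v^T by rewrite -trmxZ -Av trmx_mul sB.
    by rewrite scalerA -{2}ss mulKf ?gt_eqF.
have [X oX Xu] := householder uu; have [Y oY Yv] := householder vv.
have E := deflate oX oY Xu Yv Bv uB.
have [K [L [d [oK oL d0 BE]]]] := IH (@drsubmx _ 1 m 1 m (X^T *m B *m Y)).
exists (X *m block_mx (1%:M : 'M_1) 0 0 K), (Y *m block_mx (1%:M : 'M_1) 0 0 L).
exists (row_mx (s%:M : 'M_1) d); split.
- by apply: orthogonal_mul => //; apply: orthogonal_block.
- by apply: orthogonal_mul => //; apply: orthogonal_block.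
- move=> i; rewrite mxE; case: splitP => // k _; by rewrite ord1 mxE eqxx.
- by apply: svd_step => //; rewrite -BE.
Qed.

Lemma quadratic_diag m (H : 'M[R]_m) (d : 'rV[R]_m) (v : 'cV[R]_m) :
  (v^T *m (H *m diag_mx d *m H^T) *m v) 0 0 =
  \sum_i d 0 i * (H^T *m v) i 0 ^+ 2.
Proof.
have -> : v^T *m (H *m diag_mx d *m H^T) *m v =
    (H^T *m v)^T *m diag_mx d *m (H^T *m v) by rewrite trmx_mul trmxK !mulmxA.
move: (H^T *m v) => y; rewrite mul_mx_diag mxE.
by apply: eq_bigr => i _; rewrite !mxE expr2 mulrAC mulrC.
Qed.

(** From B = X D Y^T take U = X Y^T and P = Y D Y^T. *)
Lemma polar_exists m (B : 'M[R]_m) : exists U P, polar_decomposition B U P.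
Proof.
have [X [Y [d [oX oY d0 ->]]]] := svd B.
exists (X *m Y^T), (Y *m diag_mx d *m Y^T); split.
- by apply: orthogonal_mul => //; apply: orthogonal_tr.
- split; first by rewrite !trmx_mul trmxK tr_diag_mx mulmxA.
  by move=> v; rewrite quadratic_diag sumr_ge0 // => i _; rewrite mulr_ge0 ?sqr_ge0.
- by rewrite !mulmxA -(mulmxA X Y^T) oY mulmx1.
Qed.

(** * Reflections and trace inequalities *)

Definition reflection m (v : 'cV[R]_m) : 'M[R]_m := 1%:M - 2 *: (v *m v^T).

Lemma tr_reflection m (v : 'cV[R]_m) : (reflection v)^T = reflection v.
Proof. by rewrite /reflection trmxB trmxZ trmx1 trmx_mul trmxK. Qed.

Lemma reflection_self m (v : 'cV[R]_m) :
  v^T *m v = 1%:M -> reflection v *m v = - v.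
Proof.
move=> vv; rewrite mulmxBl mul1mx -scalemxAl -mulmxA vv mulmx1.
by rewrite scaler_nat mulr2n opprD addrA subrr add0r.
Qed.

Lemma reflectionK m (v : 'cV[R]_m) :
  v^T *m v = 1%:M -> reflection v *m reflection v = 1%:M.
Proof.
move=> vv; rewrite {2}/reflection mulmxBr mulmx1 -scalemxAr mulmxA.
by rewrite reflection_self // mulNmx scalerN opprK subrK.
Qed.

Lemma orthogonal_reflection m (v : 'cV[R]_m) :
  v^T *m v = 1%:M -> orthogonal_mx (reflection v).
Proof. by move=> vv; rewrite /orthogonal_mx tr_reflection reflectionK. Qed.

(** Matrix determinant lemma: one block matrix is factored into block triangular ones in two
    ways. *)
Lemma det_rank1_update m (x y : 'cV[R]_m) :
  \det (1%:M + x *m y^T) = 1 + (y^T *m x) 0 0.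
Proof.
have : block_mx 1%:M 0 x 1%:M *m block_mx (1%:M : 'M_1) (- y^T) 0 (1%:M + x *m y^T)
     = block_mx (1%:M + y^T *m x) (- y^T) 0 1%:M *m block_mx 1%:M 0 x 1%:M.
  rewrite !mulmx_block !(mul0mx, mul1mx, mulmx0, mulmx1, addr0, add0r, mulNmx).
  by rewrite mulmxN addrK addrCA addNr addr0.
move/(congr1 determinant); rewrite !det_mulmx !det_lblock !det_ublock !det1.
by rewrite !mul1r !mulr1 det_mx11 mxE mxE eqxx.
Qed.

Lemma det_reflection m (v : 'cV[R]_m) :
  v^T *m v = 1%:M -> \det (reflection v) = -1.
Proof.
move=> vv; rewrite /reflection -scaleNr scalemxAl det_rank1_update.
by rewrite -scalemxAr vv !mxE eqxx mulr1; ring.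
Qed.

Lemma reflection_ker m (P : 'M[R]_m) (v : 'cV[R]_m) :
  P^T = P -> P *m v = 0 -> reflection v *m P = P.
Proof.
move=> sP Pv; rewrite mulmxBl mul1mx -scalemxAl -mulmxA.
have -> : v^T *m P = 0 by rewrite -[LHS]trmxK trmx_mul trmxK sP Pv trmx0.
by rewrite mulmx0 scaler0 subr0.
Qed.

Lemma tr_mul_reflection m (A : 'M[R]_m) (v : 'cV[R]_m) (a : R) :
  v^T *m v = 1%:M -> A *m v = a *: v -> \tr (A *m reflection v) = \tr A - 2 * a.
Proof.
move=> vv Av; rewrite mulmxBr mulmx1 -scalemxAr mulmxA Av -scalemxAl.
by rewrite linearB /= !linearZ /= mxtrace_mulC vv mxtrace1 mulr1.
Qed.

Lemma psd_kernel m (P : 'M[R]_m) (v : 'cV[R]_m) :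
  psd_mx P -> (v^T *m P *m v) 0 0 = 0 -> P *m v = 0.
Proof.
move=> [sP Pge0] vPv; apply/eqP; rewrite -sqnorm_eq0; set w := P *m v.
set q := (_ 0 0); apply/negPn/negP => q0.
have {}q0 : 0 < q by rewrite lt_neqAle eq_sym q0 sqnorm_ge0.
set r := (w^T *m P *m w) 0 0; have r0 : 0 <= r by exact: Pge0.
(* The form is negative at v - t w unless q = 0. *)
pose t := q / (r + 1).
have vP : v^T *m P = w^T by rewrite /w trmx_mul sP.
have : 0 <= - (2 * t * q) + t ^+ 2 * r.
  rewrite (_ : _ + _ = ((v - t *: w)^T *m P *m (v - t *: w)) 0 0) //.
  have entryB (A B : 'M[R]_1) : (A - B) 0 0 = A 0 0 - B 0 0 by rewrite !mxE.
  have entryZ c (A : 'M[R]_1) : (c *: A) 0 0 = c * A 0 0 by rewrite !mxE.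
  rewrite trmxB trmxZ !mulmxBl !mulmxBr -!scalemxAl -!scalemxAr.
  rewrite !(entryB, entryZ) vPv -/r vP -(mulmxA _ P v) -/w -/q; ring.
(* The shift by 1 in the denominator of [t] covers r = 0; the resulting value is visibly
   negative. *)
have -> : - (2 * t * q) + t ^+ 2 * r = - (q ^+ 2 * (r + 2) / (r + 1) ^+ 2).
  by rewrite /t; field; rewrite gt_eqF // ltr_wpDl.
rewrite oppr_ge0 leNgt divr_gt0 ?exprn_gt0 ?mulr_gt0 ?exprn_gt0 //.
- by rewrite ltr_wpDl.
- by rewrite ltr_wpDl.
Qed.

Lemma mxtrace_quadratic k m (P : 'M[R]_m) (X : 'M[R]_(k, m)) :
  \tr (X *m P *m X^T) = \sum_i ((row i X)^T^T *m P *m (row i X)^T) 0 0.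
Proof.
apply: eq_bigr => i _; rewrite trmxK -row_mul tr_row !mxE.
by apply: eq_bigr => j _; rewrite !mxE.
Qed.

Lemma mxtrace_quadratic_ge0 k m (P : 'M[R]_m) (X : 'M[R]_(k, m)) :
  psd_mx P -> 0 <= \tr (X *m P *m X^T).
Proof. by case=> _ Pge0; rewrite mxtrace_quadratic sumr_ge0. Qed.

(** The trace sums nonnegative values of the form at the rows of X, so each value vanishes and
    [psd_kernel] applies row by row. *)
Lemma mxtrace_quadratic_eq0 k m (P : 'M[R]_m) (X : 'M[R]_(k, m)) :
  psd_mx P -> \tr (X *m P *m X^T) = 0 -> X *m P = 0.
Proof.
move=> pP; have [sP Pge0] := pP.
rewrite mxtrace_quadratic => /psumr_eq0P X0; apply/row_matrixP => i.
rewrite row0 row_mul -[LHS]trmxK trmx_mul sP psd_kernel ?trmx0 //.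
by apply: X0 => // j _; exact: Pge0.
Qed.

Lemma mxtrace_orthogonal_psd m (O P : 'M[R]_m) :
  orthogonal_mx O -> psd_mx P ->
  \tr (O *m P) <= \tr P ?= iff (O *m P == P).
Proof.
move=> oO pP; have [sP _] := pP.
have E : \tr ((O - 1%:M) *m P *m (O - 1%:M)^T) = 2 * (\tr P - \tr (O *m P)).
  rewrite trmxB trmx1 !(mulmxBl, mulmxBr, mul1mx, mulmx1) !linearB /=.
  (* Cyclicity gives tr(O P O^T) = tr P, and symmetry of P gives tr(P O^T) = tr(O P). *)
  rewrite mxtrace_mulC mulmxA oO mul1mx.
  rewrite -[\tr (P *m O^T)]mxtrace_tr trmx_mul trmxK sP; ring.
split.
  by rewrite -subr_ge0 -(pmulr_rge0 _ (ltr0n R 2)) -E mxtrace_quadratic_ge0.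
apply/eqP/eqP => [e|->//].
have : (O - 1%:M) *m P = 0.
  by apply: mxtrace_quadratic_eq0 => //; rewrite E e subrr mulr0.
by rewrite mulmxBl mul1mx => /eqP; rewrite subr_eq0 => /eqP.
Qed.

Lemma psd1 m : psd_mx (1%:M : 'M[R]_m).
Proof. by split=> [|v]; rewrite ?trmx1 // mulmx1 sqnorm_ge0. Qed.

Lemma orthogonal_fixed_opp m (O : 'M[R]_m) :
  orthogonal_mx O -> \det O = -1 ->
  exists2 v : 'cV[R]_m, v^T *m v = 1%:M & O *m v = - v.
Proof.
move=> oO dO; have : \det (O + 1%:M) = 0.
  (* O + 1 = O (1 + O^T) *)
  have : \det (O + 1%:M) = - \det (O + 1%:M).
    rewrite -[X in \det (_ + X) = _](orthogonal_mulmxT oO) -{1}[O]mulmx1 -mulmxDr.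
    rewrite det_mulmx dO mulN1r -[\det (1%:M + _)]det_tr linearD /=.
    by rewrite trmxK trmx1 addrC.
  by lra.
case/unit_ker => v vv Ov; exists v => //; apply/eqP.
by rewrite -addr_eq0 -{2}[v]mul1mx -mulmxDl Ov.
Qed.

Lemma mxtrace_improper m (O P : 'M[R]_m) (a : R) :
  orthogonal_mx O -> \det O = -1 -> 0 <= a -> psd_mx (P - a%:M) ->
  \tr (O *m P) <= \tr P - 2 * a /\
  (\tr (O *m P) = \tr P - 2 * a -> 0 < a ->
   exists v : 'cV[R]_m,
     [/\ v^T *m v = 1%:M, P *m v = a *: v & O = reflection v]).
Proof.
move=> oO dO a0 pP.
have [v vv Ov] := orthogonal_fixed_opp oO dO.
have oOv := orthogonal_mul oO (orthogonal_reflection vv).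
have [le1 eq1] := mxtrace_orthogonal_psd oOv (@psd1 m).
have [le2 eq2] := mxtrace_orthogonal_psd oO pP.
have trO : \tr (O *m reflection v *m 1%:M) = \tr O + 2.
  rewrite mulmx1 (@tr_mul_reflection _ _ _ (-1)) //; first by ring.
  by rewrite scaleN1r.
have trOP : \tr (O *m P) = a * \tr O + \tr (O *m (P - a%:M)).
  by rewrite mulmxBr linearB /= mul_mx_scalar linearZ /=; ring.
have trP : \tr P = a * \tr (1%:M : 'M[R]_m) + \tr (P - a%:M).
  by rewrite linearB /= -[in X in _ - X](scalemx1 m a) linearZ /=; ring.
rewrite trO in le1 eq1.
split=> [|e a_gt0].
  by rewrite trOP trP; have := ler_wpM2l a0 le1; lra.
(* The bound is a times the one on tr O plus the one for P - a, so equality in the sum forces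
   equality in both; a > 0 allows cancelling the factor. *)
have h1 : \tr O + 2 = \tr (1%:M : 'M[R]_m).
  apply/eqP; rewrite eq_le le1 /= -(ler_pM2l a_gt0).
  by move: e; rewrite trOP trP; lra.
have h2 : \tr (O *m (P - a%:M)) = \tr (P - a%:M).
  by move: e; rewrite trOP trP -h1; lra.
have Ov1 : O = reflection v.
  move/eqP: h1; rewrite eq1 mulmx1 => /eqP /(congr1 (mulmx^~ (reflection v))).
  by rewrite -mulmxA reflectionK // mulmx1 mul1mx.
exists v; split=> //; apply/eqP; rewrite -subr_eq0 -mul_scalar_mx -mulmxBl.
have [sP _] := pP.
(* Equality says that the reflection fixes P - a from the left, while it negates v^T; so v^T (P - a)
   is its own opposite. *)
move/eqP: h2; rewrite eq2 Ov1 => /eqP/(congr1 (mulmx v^T)).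
have -> : v^T *m (reflection v *m (P - a%:M)) = - (v^T *m (P - a%:M)).
  rewrite mulmxA -[v^T *m _]trmxK trmx_mul trmxK tr_reflection reflection_self //.
  by rewrite linearN /= mulNmx.
set z := v^T *m _ => zz; have : z^T = 0.
  rewrite (_ : z = 0) ?trmx0 //; apply/matrixP => i j.
  by move/matrixP/(_ i j): zz; rewrite !mxE; lra.
by rewrite trmx_mul trmxK sP => ->.
Qed.

(** * Smallest eigenvalue *)

(** [eigenvalue] speaks of row vectors; symmetry passes to columns. *)
Lemma symmetric_eigenvalueP m (P : 'M[R]_m) (a : R) : P^T = P ->
  eigenvalue P a -> exists2 v : 'cV[R]_m, v^T *m v = 1%:M & P *m v = a *: v.
Proof.
move=> sP /eigenvalueP[u uP u0].
have ut0 : u^T != 0 by rewrite trmx_eq0.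
have [s s0 ss] := normalize ut0; exists (s *: u^T) => //.
rewrite -scalemxAr -[P *m _]trmxK trmx_mul trmxK sP uP trmxZ.
by rewrite !scalerA mulrC.
Qed.

Lemma spectral_eigenvalue m (H : 'M[R]_m) (d : 'rV[R]_m) i :
  orthogonal_mx H -> eigenvalue (H *m diag_mx d *m H^T) (d 0 i).
Proof.
move=> oH; apply/eigenvalueP; exists (row i H^T); last first.
  apply: contra_neq (oner_neq0 R) => r0.
  have := congr1 (fun A => (A *m H) 0 i) r0.
  by rewrite -row_mul oH mul0mx !mxE eqxx.
rewrite -row_mul !mulmxA oH mul1mx mul_diag_mx; apply/rowP => j.
by rewrite !mxE.
Qed.

Lemma psd_subr_spectral m (H : 'M[R]_m) (d : 'rV[R]_m) (a : R) :
  orthogonal_mx H -> (forall i, a <= d 0 i) ->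
  psd_mx (H *m diag_mx d *m H^T - a%:M).
Proof.
move=> oH ad; have -> : H *m diag_mx d *m H^T - a%:M =
    H *m diag_mx (d - const_mx a) *m H^T.
  rewrite linearB /= mulmxBr mulmxBl diag_const_mx mul_mx_scalar -scalemxAl.
  by rewrite orthogonal_mulmxT // scalemx1.
split; first by rewrite !trmx_mul trmxK tr_diag_mx mulmxA.
move=> v; rewrite quadratic_diag sumr_ge0 // => i _.
by rewrite mulr_ge0 ?sqr_ge0 // !mxE subr_ge0.
Qed.

Lemma quadratic_subr_eigenvector m (P : 'M[R]_m) (a b : R) (v : 'cV[R]_m) :
  v^T *m v = 1%:M -> P *m v = b *: v ->
  (v^T *m (P - a%:M) *m v) 0 0 = b - a.
Proof.
move=> vv Pv; rewrite -mulmxA mulmxBl Pv mul_scalar_mx -scalerBl -scalemxAr vv.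
by rewrite !mxE eqxx mulr1.
Qed.

(** Diagonal entries of a spectral decomposition are eigenvalues, hence at least a. This turns
    minimality among eigenvalues into the form inequality used by [mxtrace_improper]. *)
Lemma smallest_eigenvalue_psd m (P : 'M[R]_m.+1) (a : R) :
  P^T = P -> smallest_eigenvalue P a -> psd_mx (P - a%:M).
Proof.
move=> sP [_ amin]; have [b [v [vv Pv]]] := symmetric_unit_eigenvector sP.
have [H [d [oH _ PE]]] := spectral_first sP vv Pv.
rewrite PE; apply: psd_subr_spectral => // i; apply: amin.
by rewrite PE spectral_eigenvalue.
Qed.

(** The least diagonal entry d of a spectral decomposition works: the form of P - d is nonnegative
    and equals c - d at a unit eigenvector for c. *)
Lemma smallest_eigenvalue_exists m (P : 'M[R]_m.+1) :
  P^T = P -> exists a, smallest_eigenvalue P a.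
Proof.
move=> sP; have [b [v [vv Pv]]] := symmetric_unit_eigenvector sP.
have [H [d [oH _ PE]]] := spectral_first sP vv Pv.
pose i0 := [arg min_(i < ord0) d 0 i]%O.
exists (d 0 i0); split; first by rewrite PE spectral_eigenvalue.
move=> c /(symmetric_eigenvalueP sP)[u uu Pu].
rewrite -subr_ge0 -(quadratic_subr_eigenvector _ uu Pu).
have [_] : psd_mx (P - (d 0 i0)%:M); last exact.
rewrite PE; apply: psd_subr_spectral => // i.
by rewrite /i0; case: arg_minP => // k _; apply.
Qed.

Lemma psd_eigenvalue_ge0 m (P : 'M[R]_m) (a : R) :
  psd_mx P -> eigenvalue P a -> 0 <= a.
Proof.
move=> [sP Pge0] /(symmetric_eigenvalueP sP)[v vv Pv].
have := Pge0 v; rewrite -[P]subr0 -(raddf0 (@scalar_mx R m)).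
by rewrite (quadratic_subr_eigenvector _ vv Pv) subr0.
Qed.

Lemma psd_det_ge0 m (P : 'M[R]_m.+1) : psd_mx P -> 0 <= \det P.
Proof.
move=> pP; have [sP _] := pP.
have [b [v [vv Pv]]] := symmetric_unit_eigenvector sP.
have [H [d [oH _ PE]]] := spectral_first sP vv Pv.
rewrite PE det_mulmx mulrC det_mulmx mulrA -det_mulmx oH det1 mul1r det_diag.
rewrite prodr_ge0 // => i _; apply: (psd_eigenvalue_ge0 pP).
by rewrite PE spectral_eigenvalue.
Qed.

(** At a unit kernel vector the form of P - a would be -a < 0. *)
Lemma smallest_eigenvalue_det_gt0 m (P : 'M[R]_m.+1) (a : R) :
  psd_mx P -> smallest_eigenvalue P a -> 0 < a -> 0 < \det P.
Proof.
move=> pP aP a_gt0; have [sP _] := pP.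
rewrite lt_neqAle psd_det_ge0 // andbT eq_sym; apply/eqP.
case/unit_ker => v vv Pv; have [_ /(_ v)] := smallest_eigenvalue_psd sP aP.
rewrite (@quadratic_subr_eigenvector _ _ _ 0 _ vv) ?scale0r //; lra.
Qed.

(** * The matrices H J H^T as reflections *)

Lemma flip_first_reflection n : flip_first R n = reflection (delta_mx ord0 ord0).
Proof.
rewrite /flip_first /reflection [1%:M in RHS](@scalar_mx_block _ 1 n).
rewrite trmx_delta mul_delta_mx; apply/matrixP => i j.
rewrite !mxE; case: splitP => k ik; rewrite !mxE;
  case: splitP => l jl; rewrite !mxE -!val_eqE /= ik jl ?ord1 /=; lra.
Qed.

Lemma conj_reflection m (H : 'M[R]_m) (v : 'cV[R]_m) :
  orthogonal_mx H -> H *m reflection v *m H^T = reflection (H *m v).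
Proof.
move=> oH; rewrite /reflection mulmxBr mulmx1 -scalemxAr mulmxBl -scalemxAl.
by rewrite orthogonal_mulmxT // trmx_mul !mulmxA.
Qed.

Lemma conj_flip_first n (H : 'M[R]_n.+1) :
  orthogonal_mx H -> H *m flip_first R n *m H^T = reflection (col ord0 H).
Proof. by move=> oH; rewrite flip_first_reflection conj_reflection // colE. Qed.

(** Lets every reflection along a unit eigenvector for a be written as H J H^T. *)
Lemma smallest_first_eigenbasis_exists n (P : 'M[R]_n.+1) (a : R) (v : 'cV[R]_n.+1) :
  P^T = P -> smallest_eigenvalue P a -> v^T *m v = 1%:M -> P *m v = a *: v ->
  exists2 H, smallest_first_eigenbasis P H & col ord0 H = v.
Proof.
move=> sP aP vv Pv; have [H [d [oH Hv PE]]] := spectral_first sP vv Pv.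
exists H => //; split => //; last first.
  by exists a => //; split; rewrite Hv ?unit_neq0.
move=> j; exists (d 0 j); split.
  apply: contra_neq (oner_neq0 R) => r0.
  have := congr1 (fun A => (H^T *m A) j 0) r0.
  by rewrite colE mulmxA oH mul1mx mulmx0 !mxE !eqxx.
rewrite PE !colE -!mulmxA (mulmxA H^T) oH mul1mx scalemxAr; congr (_ *m _).
apply/matrixP => i k; rewrite mul_diag_mx !mxE; case: eqP => [->//|_].
by rewrite !mulr0.
Qed.

Lemma smallest_first_eigenbasis_col0 n (P H : 'M[R]_n.+1) (a : R) :
  smallest_first_eigenbasis P H -> smallest_eigenvalue P a ->
  [/\ orthogonal_mx H, (col ord0 H)^T *m col ord0 H = 1%:M &
      P *m col ord0 H = a *: col ord0 H].
Proof.
move=> [oH _ [b [eb bmin] [_ Pb]]] [ea amin].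
have <- : b = a by apply/le_anti; rewrite amin // bmin.
split=> //; rewrite colE trmx_mul -mulmxA (mulmxA H^T) oH mul1mx.
by rewrite trmx_delta mul_delta_mx; apply/matrixP => i j; rewrite !ord1 !mxE.
Qed.

(** * Eigenvalues of multiplicity at most one *)

Lemma rank_le1_proportional m (E : 'M[R]_m) (u v : 'rV[R]_m) :
  (\rank E <= 1)%N -> u != 0 -> (u <= E)%MS -> (v <= E)%MS ->
  exists k, v = k *: u.
Proof.
move=> rE u0 uE vE; apply/sub_rVP; apply: submx_trans vE _.
have [_ <-] := mxrank_leqif_sup uE.
by rewrite eqn_leq mxrankS //= rank_rV u0.
Qed.

(** Unit vectors on one line differ by a factor k with k^2 = 1, which v v^T does not see. *)
Lemma reflection_simple_eigenvalue m (P : 'M[R]_m) (a : R) (u v : 'cV[R]_m) :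
  P^T = P -> (multiplicity P a <= 1)%N ->
  u^T *m u = 1%:M -> v^T *m v = 1%:M -> P *m u = a *: u -> P *m v = a *: v ->
  reflection u = reflection v.
Proof.
move=> sP rP uu vv Pu Pv.
have inE w : P *m w = a *: w -> (w^T <= eigenspace P a)%MS.
  by move=> Pw; apply/eigenspaceP; rewrite -{1}sP -trmx_mul Pw trmxZ.
have u0 : u^T != 0 by rewrite trmx_eq0 unit_neq0.
have [k vk] := rank_le1_proportional rP u0 (inE _ _ Pu) (inE _ _ Pv).
have {}vk : v = k *: u by rewrite -[v]trmxK vk trmxZ trmxK.
have kk : k * k = 1.
  move/matrixP/(_ 0 0): vv.
  by rewrite vk trmxZ -scalemxAl -scalemxAr uu scalerA !mxE eqxx mulr1.
congr (_ - _ *: _); rewrite vk trmxZ -scalemxAl -scalemxAr scalerA kk.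
by rewrite scale1r.
Qed.

Lemma multiplicity0 m (A : 'M[R]_m) : multiplicity A 0 = (m - \rank A)%N.
Proof. by rewrite /multiplicity /eigenspace raddf0 subr0 mxrank_ker. Qed.

(** For singular P the rows of O - 1 lie in the kernel line spanned by h, so O = 1 + x h^T.
    Determinant 1 gives h^T x = 0, hence O^T h = h, hence O h = h, and O h = h + x yields x = 0. *)
Lemma orthogonal_fix_corank1 m (O P : 'M[R]_m) :
  orthogonal_mx O -> \det O = 1 -> P^T = P -> O *m P = P ->
  (multiplicity P 0 <= 1)%N -> O = 1%:M.
Proof.
move=> oO dO sP OP rP.
have OP0 : (O - 1%:M) *m P = 0 by rewrite mulmxBl mul1mx OP subrr.
have [dP|dP] := eqVneq (\det P) 0; last first.
  have Pu : P \in unitmx by rewrite unitmxE unitfE.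
  apply/eqP; rewrite -subr_eq0 -[_ - _](mulmxK Pu) OP0 mul0mx; exact/eqP.
have [h hh Ph] := unit_ker dP.
have hP : (h^T <= kermx P)%MS.
  by apply/sub_kermxP; rewrite -[LHS]trmxK trmx_mul trmxK sP Ph trmx0.
have : (O - 1%:M <= h^T)%MS.
  apply: (@submx_trans _ _ _ _ _ _ (kermx P)); first exact/sub_kermxP.
  have [_ <-] := mxrank_leqif_sup hP.
  rewrite eqn_leq mxrankS //= rank_rV trmx_eq0 unit_neq0 //.
  by rewrite mxrank_ker -multiplicity0.
case/submxP => x; move/eqP; rewrite subr_eq addrC => /eqP OE.
have hx : h^T *m x = 0.
  have := dO; rewrite OE det_rank1_update => /(canRL (addKr _)).
  by rewrite addNr => e; rewrite [LHS]mx11_scalar e raddf0.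
have OTh : O^T *m h = h.
  rewrite OE linearD /= trmx1 mulmxDl mul1mx trmx_mul trmxK -mulmxA.
  by rewrite -[x^T *m h]trmxK trmx_mul trmxK hx trmx0 mulmx0 addr0.
have Oh : O *m h = h by rewrite -{1}OTh mulmxA orthogonal_mulmxT // mul1mx.
have x0 : x = 0.
  move: Oh; rewrite OE mulmxDl mul1mx -mulmxA hh mulmx1.
  by move/(canRL (addKr _)); rewrite addNr.
by rewrite OE x0 mul0mx addr0.
Qed.

(** * Trace maximization over the rotations *)

Lemma sqr_frobenius m (A : 'M[R]_m) : frobenius A ^+ 2 = \tr (A^T *m A).
Proof.
have := mxtrace_quadratic_ge0 A^T (@psd1 m); rewrite mulmx1 trmxK.
exact: sqr_sqrtr.
Qed.

Lemma sqr_frobenius_orthogonal m (A B : 'M[R]_m) :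
  orthogonal_mx A -> orthogonal_mx B ->
  frobenius (A - B) ^+ 2 = 2 * \tr (1%:M : 'M[R]_m) - 2 * \tr (B^T *m A).
Proof.
move=> oA oB; rewrite sqr_frobenius trmxB mulmxBl !mulmxBr oA oB !linearB /=.
by rewrite -[\tr (A^T *m B)]mxtrace_tr trmx_mul trmxK; ring.
Qed.

(** Solutions of the orthogonal Procrustes problem restricted to rotations. *)
Definition procrustes_argmax m (B : 'M[R]_m) : set 'M[R]_m :=
  [set c | SO c /\ forall c', SO c' -> \tr (c'^T *m B) <= \tr (c^T *m B)].

Lemma IAM_argmax m N (w : 'I_N -> R) (Q : 'I_N -> 'M[R]_m) :
  (0 < N)%N -> (forall k, 0 < w k) -> (forall k, SO (Q k)) ->
  IAM w Q = procrustes_argmax (centroid w Q).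
Proof.
move=> hN hw hQ; pose W := \sum_(k < N) w k.
(* Positivity makes the inverse in [centroid] genuine and keeps the direction of the
   inequalities. *)
have W0 : 0 < W.
  apply: lt_le_trans (hw (Ordinal hN)) _.
  by rewrite /W (bigD1 (Ordinal hN)) //= lerDl sumr_ge0 // => k _; exact: ltW.
have costE c : SO c -> \sum_(k < N) w k * frobenius (Q k - c) ^+ 2 =
    2 * W * \tr (1%:M : 'M[R]_m) - 2 * W * \tr (c^T *m centroid w Q).
  move=> [oc _]; rewrite -!mulrA.
  have -> : W * \tr (c^T *m centroid w Q) = \sum_k w k * \tr (c^T *m Q k).
    rewrite /centroid -scalemxAr linearZ /= mulrA divff ?gt_eqF // mul1r.
    rewrite mulmx_sumr linear_sum /=; apply: eq_bigr => k _.
    by rewrite -scalemxAr linearZ.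
  rewrite mulr_suml !mulr_sumr -sumrB.
  apply: eq_bigr => k _; have [ok _] := hQ k.
  by rewrite sqr_frobenius_orthogonal //; ring.
have W2 : 0 < 2 * W by rewrite mulr_gt0.
apply/seteqP; split=> c [Sc cmin]; split=> // c' Sc'; move: (cmin c' Sc').
  by rewrite !costE // lerD2l lerN2 ler_pM2l.
by rewrite !costE // lerD2l lerN2 ler_pM2l.
Qed.

(** The trace bound for O = c^T U; its equality case O P = P, multiplied by c, says that c is itself
    an orthogonal polar factor. *)
Lemma mxtrace_polar m (B U P c : 'M[R]_m) :
  polar_decomposition B U P -> orthogonal_mx c ->
  \tr (c^T *m B) <= \tr P ?= iff (c *m P == B).
Proof.
move=> [oU pP ->] oc.
have -> : (c *m P == U *m P) = (c^T *m U *m P == P).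
  apply/eqP/eqP => [e|e]; first by rewrite -mulmxA -e mulmxA oc mul1mx.
  by rewrite -{1}e !mulmxA orthogonal_mulmxT // mul1mx.
rewrite mulmxA; apply: mxtrace_orthogonal_psd => //.
by apply: orthogonal_mul => //; apply: orthogonal_tr.
Qed.

Lemma polar_det m (B U P : 'M[R]_m) :
  polar_decomposition B U P -> \det B = \det U * \det P.
Proof. by case=> _ _ ->; rewrite det_mulmx. Qed.

(** For singular P this switches the sign of det U while keeping P. *)
Lemma polar_reflection m (B U P : 'M[R]_m) (v : 'cV[R]_m) :
  polar_decomposition B U P -> v^T *m v = 1%:M -> P *m v = 0 ->
  polar_decomposition B (U *m reflection v) P.
Proof.
move=> [oU pP ->] vv Pv; have [sP _] := pP.
split=> //; first by apply: orthogonal_mul => //; apply: orthogonal_reflection.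
by rewrite -mulmxA reflection_ker.
Qed.

Lemma det_mul_reflection m (U : 'M[R]_m) (v : 'cV[R]_m) :
  v^T *m v = 1%:M -> \det (U *m reflection v) = - \det U.
Proof. by move=> vv; rewrite det_mulmx det_reflection // mulrN1. Qed.

(** Here e is the wanted sign. If U has the other one, the sign condition on det B forces det P = 0,
    and a reflection along the kernel of P repairs U. *)
Lemma polar_exists_det m (B : 'M[R]_m.+1) (e : R) :
  e = 1 \/ e = -1 -> 0 <= e * \det B ->
  exists U P, polar_decomposition B U P /\ \det U = e.
Proof.
move=> e1 eB; have [U [P BUP]] := polar_exists B; have [oU pP _] := BUP.
have [Ue|Ue] : \det U = e \/ \det U = - e.
  by case: (det_orthogonal oU) => ->; case: e1 => ->; rewrite ?opprK; tauto.
  by exists U, P.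
have dP : \det P = 0.
  apply/eqP; rewrite eq_le psd_det_ge0 // andbT.
  by move: eB; rewrite (polar_det BUP) Ue; case: e1 => ->; lra.
have [v vv Pv] := unit_ker dP.
exists (U *m reflection v), P; split; first exact: polar_reflection.
by rewrite det_mul_reflection // Ue opprK.
Qed.

(** U is a rotation attaining the bound tr P, so the maximizers are exactly the equality cases. *)
Lemma procrustes_argmax_proper m (B U P c : 'M[R]_m) :
  polar_decomposition B U P -> \det U = 1 ->
  procrustes_argmax B c <-> SO c /\ c *m P = B.
Proof.
move=> BUP dU; have [oU _ BE] := BUP.
split=> [[Sc cmax]|[Sc cP]].
  split=> //; apply/eqP; case: Sc => oc _.
  rewrite -(mxtrace_polar BUP oc) eq_le (mxtrace_polar BUP oc) /=.
  have /eqP <- : \tr (U^T *m B) == \tr P by rewrite (mxtrace_polar BUP oU) BE.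
  by apply: cmax; split.
split=> // c' [oc' _]; have [oc _] := Sc.
have /eqP -> : \tr (c^T *m B) == \tr P by rewrite (mxtrace_polar BUP oc) cP.
by rewrite (mxtrace_polar BUP oc').
Qed.

Lemma procrustes_argmax_proper_set m (B : 'M[R]_m.+1) :
  0 <= \det B ->
  procrustes_argmax B =
    [set U | (exists P, polar_decomposition B U P) /\ 0 < \det U].
Proof.
move=> dB; have [|U [P [BUP dU]]] := @polar_exists_det m B 1 (or_introl erefl).
  by rewrite mul1r.
have [_ pP _] := BUP.
apply/seteqP; split=> c.
  move/(procrustes_argmax_proper _ BUP dU) => [[oc dc] cP].
  by split; [exists P | rewrite dc].
move=> [[P' BcP']] dc; have [oc _ BE] := BcP'.
have {}dc : \det c = 1 by case: (det_orthogonal oc) dc => ->; lra.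
by apply/(procrustes_argmax_proper _ BcP' dc).
Qed.

Lemma polar_multiplicity0 m (B U P : 'M[R]_m) :
  polar_decomposition B U P -> multiplicity B 0 = multiplicity P 0.
Proof.
move=> [oU _ ->]; rewrite !multiplicity0 -[\rank (_ *m _)]mxrank_tr trmx_mul.
by rewrite mxrankMfree ?mxrank_tr // row_free_unit (mulmx1_unit oU).1.
Qed.

(** For a maximizer c, the rotation U^T c fixes P from the left, and P has corank at most 1. *)
Lemma procrustes_argmax_proper_unique m (B : 'M[R]_m.+1) :
  0 <= \det B -> (multiplicity B 0 <= 1)%N ->
  exists c, procrustes_argmax B = [set c].
Proof.
move=> dB; have [|U [P [BUP dU]]] := @polar_exists_det m B 1 (or_introl erefl).
  by rewrite mul1r.
have [oU [sP _] BE] := BUP; rewrite (polar_multiplicity0 BUP).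
move=> rP; exists U; apply/seteqP; split=> c.
  move/(procrustes_argmax_proper _ BUP dU) => [[oc dc] cP].
  have : U^T *m c = 1%:M.
    apply: (orthogonal_fix_corank1 _ _ sP _ rP).
    - by apply: orthogonal_mul => //; apply: orthogonal_tr.
    - by rewrite det_mulmx det_tr dU dc mulr1.
    - by rewrite -mulmxA cP BE mulmxA oU mul1mx.
  by move/(congr1 (mulmx U)); rewrite mulmxA orthogonal_mulmxT // mul1mx mulmx1.
by move=> ->; apply/(procrustes_argmax_proper _ BUP dU).
Qed.

(** The factor U' is existential because for a = 0 it may differ from U; for a > 0 it is U. *)
Lemma mxtrace_polar_improper m (B U P c : 'M[R]_m.+1) (a : R) :
  polar_decomposition B U P -> \det U = -1 -> smallest_eigenvalue P a ->
  SO c ->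
  \tr (c^T *m B) <= \tr P - 2 * a /\
  (\tr (c^T *m B) = \tr P - 2 * a ->
   exists U' (v : 'cV[R]_m.+1),
     [/\ polar_decomposition B U' P, \det U' = -1, v^T *m v = 1%:M,
         P *m v = a *: v & c = U' *m reflection v]).
Proof.
move=> BUP dU aP [oc dc]; have [oU pP BE] := BUP; have [sP _] := pP.
have a_ge0 := psd_eigenvalue_ge0 pP aP.1.
have oO := orthogonal_mul (orthogonal_tr oc) oU.
have dO : \det (c^T *m U) = -1 by rewrite det_mulmx det_tr dc dU mul1r.
have [le1 eq1] := mxtrace_improper oO dO a_ge0 (smallest_eigenvalue_psd sP aP).
rewrite BE mulmxA; split=> // e.
move: a_ge0; rewrite le_eqVlt => /orP[/eqP a0|a_gt0].
  (* With a = 0, c attains tr P and is a polar factor of determinant 1; a reflection along the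
     kernel makes it improper. *)
  have [v vv Pv] := symmetric_eigenvalueP sP aP.1.
  have cP : c *m P = B.
    apply/eqP; rewrite -(mxtrace_polar BUP oc) BE mulmxA e -a0; apply/eqP; ring.
  have BcP : polar_decomposition B c P by split.
  exists (c *m reflection v), v; split=> //.
  - by rewrite -BE; apply: (polar_reflection BcP vv); rewrite Pv -a0 scale0r.
  - by rewrite det_mul_reflection // dc.
  - by rewrite -mulmxA reflectionK // mulmx1.
have [v [vv Pv OE]] := eq1 e a_gt0.
exists U, v; split=> //.
have cU : U = c *m reflection v.
  by rewrite -OE mulmxA orthogonal_mulmxT // mul1mx.
by rewrite cU -mulmxA reflectionK // mulmx1.
Qed.

Lemma mxtrace_polar_reflection m (B U P : 'M[R]_m) (v : 'cV[R]_m) (a : R) :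
  polar_decomposition B U P -> v^T *m v = 1%:M -> P *m v = a *: v ->
  \tr ((U *m reflection v)^T *m B) = \tr P - 2 * a.
Proof.
move=> [oU _ ->] vv Pv; rewrite trmx_mul tr_reflection -mulmxA (mulmxA U^T) oU.
by rewrite mul1mx mxtrace_mulC (tr_mul_reflection vv Pv).
Qed.

Lemma SO_mul_reflection m (U : 'M[R]_m) (v : 'cV[R]_m) :
  orthogonal_mx U -> \det U = -1 -> v^T *m v = 1%:M -> SO (U *m reflection v).
Proof.
move=> oU dU vv; split; last by rewrite det_mul_reflection // dU opprK.
by apply: orthogonal_mul => //; apply: orthogonal_reflection.
Qed.

Lemma procrustes_argmax_reflection m (B U P : 'M[R]_m.+1) (a : R) (v : 'cV[R]_m.+1) :
  polar_decomposition B U P -> \det U = -1 -> smallest_eigenvalue P a ->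
  v^T *m v = 1%:M -> P *m v = a *: v ->
  procrustes_argmax B (U *m reflection v).
Proof.
move=> BUP dU aP vv Pv; have [oU _ _] := BUP.
split=> [|c Sc]; first exact: SO_mul_reflection.
rewrite (mxtrace_polar_reflection BUP vv Pv).
by have [] := mxtrace_polar_improper BUP dU aP Sc.
Qed.

Lemma procrustes_argmax_improper_set m (B : 'M[R]_m.+1) :
  \det B <= 0 ->
  procrustes_argmax B =
    [set c | exists U P H,
      [/\ polar_decomposition B U P, \det U < 0, smallest_first_eigenbasis P H
        & c = U *m H *m flip_first R m *m H^T]].
Proof.
move=> dB; have [|U [P [BUP dU]]] := @polar_exists_det m B (-1) (or_intror erefl).
  by rewrite mulN1r oppr_ge0.
have [oU pP BE] := BUP; have [sP _] := pP.
have [a aP] := smallest_eigenvalue_exists sP.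
have [v vv Pv] := symmetric_eigenvalueP sP aP.1.
apply/seteqP; split=> c.
  move=> [Sc cmax]; have [le1 eq1] := mxtrace_polar_improper BUP dU aP Sc.
  have [|U' [u [BUP' dU' uu Pu ->]]] := eq1.
    apply/le_anti; rewrite le1 /= -(mxtrace_polar_reflection BUP vv Pv).
    exact/cmax/SO_mul_reflection.
  have [H PH Hu] := smallest_first_eigenbasis_exists sP aP uu Pu.
  exists U', P, H; split=> //; first by rewrite dU'; lra.
  by case: PH => oH _ _; rewrite -!mulmxA (mulmxA H) conj_flip_first // Hu.
(* From here the given decomposition replaces the chosen one as reference for the trace bound. *)
move=> [U' [P' [H [BUP' dU' PH ->]]]] {U P BUP dU oU pP BE sP a aP v vv Pv}.
have [oU pP BE] := BUP'; have [sP _] := pP.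
have {}dU' : \det U' = -1 by case: (det_orthogonal oU) dU' => ->; lra.
have [a aP] := smallest_eigenvalue_exists sP.
have [oH hh Ph] := smallest_first_eigenbasis_col0 PH aP.
rewrite -!mulmxA (mulmxA H) conj_flip_first //.
exact: (procrustes_argmax_reflection BUP' dU' aP hh Ph).
Qed.

(** If a = 0, then det B = 0 and 0 is a simple eigenvalue of B, so the proper case applies. If a >
    0, P is invertible, which determines U, and the eigenline determines the reflection. *)
Lemma procrustes_argmax_improper_unique m (B U P : 'M[R]_m.+1) (a : R) :
  \det B <= 0 -> polar_decomposition B U P -> smallest_eigenvalue P a ->
  multiplicity P a = 1%N -> exists c, procrustes_argmax B = [set c].
Proof.
move=> dB BUP aP rP; have [oU pP BE] := BUP; have [sP _] := pP.
have [v vv Pv] := symmetric_eigenvalueP sP aP.1.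
have := psd_eigenvalue_ge0 pP aP.1.
rewrite le_eqVlt => /orP[/eqP a0|a_gt0].
  apply: procrustes_argmax_proper_unique.
    have dP : \det P = 0.
      rewrite -det_tr sP; apply/eqP/det0P; exists v^T.
        by rewrite trmx_eq0 unit_neq0.
      by rewrite -[P]sP -trmx_mul Pv -a0 scale0r trmx0.
    by rewrite (polar_det BUP) dP mulr0.
  by rewrite (polar_multiplicity0 BUP) a0 rP.
have dP := smallest_eigenvalue_det_gt0 pP aP a_gt0.
have Pu : P \in unitmx by rewrite unitmxE unitfE gt_eqF.
have dU : \det U = -1.
  case: (det_orthogonal oU) => // dU.
  by move: dB; rewrite (polar_det BUP) dU mul1r leNgt dP.
exists (U *m reflection v); apply/seteqP; split=> [c [Sc cmax]|_ ->]; last first.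
  exact: (procrustes_argmax_reflection BUP dU aP).
have [le1 eq1] := mxtrace_polar_improper BUP dU aP Sc.
have [|U' [u [[_ _ BE'] _ uu Pu' ->]]] := eq1.
  apply/le_anti; rewrite le1 /= -(mxtrace_polar_reflection BUP vv Pv).
  exact/cmax/SO_mul_reflection.
have -> : U' = U by rewrite -[U'](mulmxK Pu) -BE' BE mulmxK.
by rewrite (reflection_simple_eigenvalue sP _ uu vv Pu' Pv) // rP.
Qed.

End RealMatrices.

Theorem proposition1 (R : realType) (n N : nat) (hN : (0 < N)%N)
    (w : 'I_N -> R) (Q : 'I_N -> 'M[R]_n.+1)
    (hw : forall k, 0 < w k) (hQ : forall k, SO (Q k)) :
  let Ce := centroid w Q in
  (0 <= \det Ce ->
     IAM w Q =
       [set U | (exists P, polar_decomposition Ce U P) /\ 0 < \det U] /\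
     ((multiplicity Ce 0 <= 1)%N -> exists c, IAM w Q = [set c])) /\
  (\det Ce <= 0 ->
     IAM w Q =
       [set c | exists U P H,
          [/\ polar_decomposition Ce U P, \det U < 0,
              smallest_first_eigenbasis P H
            & c = U *m H *m flip_first R n *m H^T]] /\
     (forall U P a, polar_decomposition Ce U P -> smallest_eigenvalue P a ->
        multiplicity P a = 1%N -> exists c, IAM w Q = [set c])).
Proof.
rewrite IAM_argmax // => Ce; split=> dC; split.
- exact: procrustes_argmax_proper_set.
- exact: procrustes_argmax_proper_unique.
- exact: procrustes_argmax_improper_set.
- by move=> U P a; exact: procrustes_argmax_improper_unique.
Qed.
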